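(* For generic $x_0,x_1,\dots,x_L$ (and $1\le i\le L$), \[ Z(X)=\det(W)\prod_{k=1}^L\frac{b(x_0-x_k)}{b(x_0-\mu_k)},\qquad Z(X_i^0)=\det(W_i)\prod_{k=1}^L\frac{b(x_0-x_k)}{b(x_0-\mu_k)}, \] where $W$ and $W_i$ are $L\times L$ matrices with, for $1\le\alpha,\beta\le L$, \[ W_{\alpha,\beta}=\begin{cases}\displaystyle\prod_{k=1}^La(x_\alpha-\mu_k)-\prod_{k=1}^Lb(x_\alpha-\mu_k)\prod_{\substack{k=0\\k\ne\alpha}}^L\frac{a(x_\alpha-x_k)}{b(x_\alpha-x_k)}&\beta=\alpha,\\[2ex] \dfrac{c(x_\alpha-x_\beta)}{b(x_\alpha-x_\beta)}\displaystyle\prod_{k=1}^Lb(x_\beta-\mu_k)\prod_{\substack{k=0\\k\ne\alpha,\beta}}^L\frac{a(x_\beta-x_k)}{b(x_\beta-x_k)}&\beta\ne\alpha,\end{cases} \] and $W_i$ equals $W$ except that its column $i$ is replaced by the column with entries \[ (W_i)_{\alpha,i}=\frac{c(x_0-x_\alpha)}{b(x_0-x_\alpha)}\prod_{k=1}^Lb(x_0-\mu_k)\prod_{\substack{k=1\\k\ne\alpha}}^L\frac{a(x_0-x_k)}{b(x_0-x_k)},\qquad1\le\alpha\le L. \] In particular the right-hand side of the first formula is independent of $x_0$.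
   Context: Six-vertex setup. Fix $\gamma\in\mathbb C$, $L\ge1$ and $\mu_1,\dots,\mu_L\in\mathbb C$. Let $a(x)=\sinh(x+\gamma)$, $b(x)=\sinh x$, $c(x)=\sinh\gamma$ (constant). With $v_1,v_2$ the standard basis of $\mathbb C^2$, let $R(x)$ be the matrix on $\mathbb C^2\otimes\mathbb C^2$ which in the ordered basis $v_1\otimes v_1,v_1\otimes v_2,v_2\otimes v_1,v_2\otimes v_2$ is $\begin{pmatrix}a(x)&0&0&0\\0&b(x)&c(x)&0\\0&c(x)&b(x)&0\\0&0&0&a(x)\end{pmatrix}$. On $\mathbb C^2_0\otimes(\mathbb C^2)^{\otimes L}$, let $T_0(x)=R_{01}(x-\mu_1)R_{02}(x-\mu_2)\cdots R_{0L}(x-\mu_L)$ (with $R_{0i}$ acting on the auxiliary factor $0$ and quantum factor $i$), written in the auxiliary space as $\begin{pmatrix}A(x)&B(x)\\C(x)&D(x)\end{pmatrix}$. With $|0\rangle=v_1^{\otimes L}$ and $\langle\bar0|=(v_2^* )^{\otimes L}$, the partition function of the six-vertex model with domain-wall boundaries is $Z(x_1,\dots,x_L)=\langle\bar0|B(x_1)B(x_2)\cdots B(x_L)|0\rangle$. Notation: $X=(x_1,\dots,x_L)$; for $1\le i\le L$, $X_i^0$ is $X$ with $x_i$ replaced by $x_0$. *)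

(* Defs.v *)
From Stdlib Require Import Reals List.
Import ListNotations.
Open Scope R_scope.

Record C := mkC { Re : R ; Im : R }.
Definition C0 : C := mkC 0 0.
Definition C1 : C := mkC 1 0.
Definition Cadd (z w : C) : C := mkC (Re z + Re w) (Im z + Im w).
Definition Copp (z : C) : C := mkC (- Re z) (- Im z).
Definition Csub (z w : C) : C := Cadd z (Copp w).
Definition Cmul (z w : C) : C :=
  mkC (Re z * Re w - Im z * Im w) (Re z * Im w + Im z * Re w).
Definition Cinv (z : C) : C :=
  mkC (Re z / (Re z * Re z + Im z * Im z)) (- Im z / (Re z * Re z + Im z * Im z)).
Definition Cdiv (z w : C) : C := Cmul z (Cinv w).
Definition Cexp (z : C) : C := mkC (exp (Re z) * cos (Im z)) (exp (Re z) * sin (Im z)).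
Definition Csinh (z : C) : C := Cmul (Csub (Cexp z) (Cexp (Copp z))) (mkC (/2) 0).

Definition Csum (l : list C) : C := fold_right Cadd C0 l.
Definition Cprod (l : list C) : C := fold_right Cmul C1 l.

Definition wa (g x : C) : C := Csinh (Cadd x g).
Definition wb (x : C) : C := Csinh x.
Definition wc (g x : C) : C := Csinh g.

(** basis of C^2: false = v_1, true = v_2.
    Entry of R(x) in row (v_a (x) v_s), column (v_b (x) v_t). *)
Definition Rent (g x : C) (a s b t : bool) : C :=
  match a, s, b, t with
  | false, false, false, false => wa g x
  | true,  true,  true,  true  => wa g x
  | false, true,  false, true  => wb x
  | true,  false, true,  false => wb x
  | false, true,  true,  false => wc g x
  | true,  false, false, true  => wc g x
  | _, _, _, _ => C0
  end.

(** Matrix entry <v_a (x) v_{sp}| T_0(x) |v_b (x) v_s> of the monodromy matrix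
    T_0(x) = R_{01}(x-mu_1) ... R_{0L}(x-mu_L); configurations are lists of
    length L. *)
Fixpoint Tent (g x : C) (mus : list C) (a : bool) (sp s : list bool) (b : bool) : C :=
  match mus, sp, s with
  | [], [], [] => if Bool.eqb a b then C1 else C0
  | mu :: mus', s1' :: sp', s1 :: s' =>
      Cadd (Cmul (Rent g (Csub x mu) a s1' false s1) (Tent g x mus' false sp' s' b))
           (Cmul (Rent g (Csub x mu) a s1' true  s1) (Tent g x mus' true  sp' s' b))
  | _, _, _ => C0
  end.

Definition Bent (g x : C) (mus : list C) (sp s : list bool) : C :=
  Tent g x mus false sp s true.

Fixpoint configs (n : nat) : list (list bool) :=
  match n with
  | O => [[]]
  | S n' => map (cons false) (configs n') ++ map (cons true) (configs n')
  end.

(** action of B(x) on a vector of (C^2)^{(x)L}, vectors = functions on configs *)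
Definition applyB (g x : C) (mus : list C) (v : list bool -> C) : list bool -> C :=
  fun sp => Csum (map (fun s => Cmul (Bent g x mus sp s) (v s)) (configs (length mus))).

Definition vac (L : nat) : list bool -> C :=
  fun s => if list_eq_dec Bool.bool_dec s (repeat false L) then C1 else C0.

(** Z(x_1,...,x_L) = <0bar| B(x_1) ... B(x_L) |0> *)
Definition Zpf (g : C) (mus : list C) (xs : list C) : C :=
  (fold_right (fun x v => applyB g x mus v) (vac (length mus)) xs) (repeat true (length mus)).

Definition minor (M : nat -> nat -> C) (j : nat) : nat -> nat -> C :=
  fun r c => M (S r) (if Nat.ltb c j then c else S c).
Fixpoint det (n : nat) (M : nat -> nat -> C) : C :=
  match n with
  | O => C1
  | S n' => Csum (map (fun j =>
        Cmul (if Nat.even j then C1 else Copp C1) (Cmul (M O j) (det n' (minor M j))))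
        (seq 0 (S n')))
  end.

Definition prodk (lo hi : nat) (P : nat -> bool) (f : nat -> C) : C :=
  Cprod (map f (filter P (seq lo (S hi - lo)))).

Definition Wentry (g : C) (L : nat) (mu x : nat -> C) (al be : nat) : C :=
  if Nat.eqb be al then
    Csub (prodk 1 L (fun _ => true) (fun k => wa g (Csub (x al) (mu k))))
         (Cmul (prodk 1 L (fun _ => true) (fun k => wb (Csub (x al) (mu k))))
               (prodk 0 L (fun k => negb (Nat.eqb k al))
                  (fun k => Cdiv (wa g (Csub (x al) (x k))) (wb (Csub (x al) (x k))))))
  else
    Cmul (Cdiv (wc g (Csub (x al) (x be))) (wb (Csub (x al) (x be))))
      (Cmul (prodk 1 L (fun _ => true) (fun k => wb (Csub (x be) (mu k))))
            (prodk 0 L (fun k => andb (negb (Nat.eqb k al)) (negb (Nat.eqb k be)))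
               (fun k => Cdiv (wa g (Csub (x be) (x k))) (wb (Csub (x be) (x k)))))).

Definition Wicol (g : C) (L : nat) (mu x : nat -> C) (al : nat) : C :=
  Cmul (Cdiv (wc g (Csub (x 0%nat) (x al))) (wb (Csub (x 0%nat) (x al))))
    (Cmul (prodk 1 L (fun _ => true) (fun k => wb (Csub (x 0%nat) (mu k))))
          (prodk 1 L (fun k => negb (Nat.eqb k al))
             (fun k => Cdiv (wa g (Csub (x 0%nat) (x k))) (wb (Csub (x 0%nat) (x k)))))).

Definition Wi_entry (g : C) (L : nat) (mu x : nat -> C) (i al be : nat) : C :=
  if Nat.eqb be i then Wicol g L mu x al else Wentry g L mu x al be.

Definition Wmat g L mu x : nat -> nat -> C := fun r c => Wentry g L mu x (S r) (S c).
Definition Wimat g L mu x i : nat -> nat -> C := fun r c => Wi_entry g L mu x i (S r) (S c).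

Definition Xlist (L : nat) (x : nat -> C) : list C := map x (seq 1 L).
Definition Xi0list (L : nat) (x : nat -> C) (i : nat) : list C :=
  map (fun k => if Nat.eqb k i then x 0%nat else x k) (seq 1 L).
Definition mulist (L : nat) (mu : nat -> C) : list C := map mu (seq 1 L).

Definition prefactor (L : nat) (mu x : nat -> C) : C :=
  prodk 1 L (fun _ => true)
    (fun k => Cdiv (wb (Csub (x 0%nat) (x k))) (wb (Csub (x 0%nat) (mu k)))).

(* Main.v *)
(** Write [b = sinh], [a z = b (z + g)], [c = b g].  The exchange relations between the
    entries [B] and [D] of the monodromy matrix make [Z] symmetric in the spectral parameters;
    [Z] is a trigonometric polynomial of degree [L - 1] in [mu_1], and at [mu_1 = x_j] it
    factors through the partition function of size [L - 1] (Korepin).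

    The matrix [W] has the shape [diag (prod_k a (x_i - mu_k)) - K diag (q_j)], where [K] is a
    Cauchy matrix with entries [c / a (x_j - x_i)].  Hence [det W] is a trigonometric polynomial
    of degree [L] in [mu_1], and at [mu_1 = x_j] the column [j] becomes diagonal, so that
    [det W] obeys the same recursion.  At [mu_1 = x_0] it vanishes: [W] is then, up to a
    rescaling of its columns, the matrix of the same shape on [L] points with only [L - 1]
    inhomogeneities, and Lagrange interpolation of [prod_k b (z - mu_k)] evaluated at
    [z = x_j + g] gives it the left null vector
    [r_i = prod_k b (x_i - mu_k) / prod_(j <> i) b (x_i - x_j)].  The [L + 1] points
    [mu_1 = x_0, ..., x_L] therefore determine [det W] and yield the first formula by induction.

    The same null vector for the matrix on the [L + 1] points [x_0, ..., x_L] relates [det W_i]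
    to the determinant [W] in which [x_0] and [x_i] are exchanged, whence the second formula. *)

Require Import Defs.
From Stdlib Require Reals Lra.
From HB Require structures.
From mathcomp Require boot.all_boot fingroup.all_fingroup algebra.all_algebra.
From mathcomp Require classical.boolp ring.

(* The module confines the imports: outside it the notations of the theorem
   keep the meaning they have in [Defs]. *)
Module SixVertex.
Import HB.structures all_boot all_fingroup all_algebra boolp ring.
Import GRing.Theory.
Set Implicit Arguments.
Unset Strict Implicit.
Unset Printing Implicit Defensive.
Local Open Scope ring_scope.

(** * The complex numbers as a field *)

HB.instance Definition _ := gen_eqMixin C.
HB.instance Definition _ := gen_choiceMixin C.

Section ComplexField.
Import Rdefinitions RIneq RealField R_sqr Rtrigo_def Rtrigo1 Exp_prop Rpower Lra Defs.
Local Open Scope R_scope.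

Lemma C_eq (z w : C) : Re z = Re w -> Im z = Im w -> z = w.
Proof. by case: z w => [a b] [c d] /= -> ->. Qed.

Lemma CaddA : associative Cadd.
Proof. by move=> x y z; apply: C_eq => /=; ring. Qed.

Lemma CaddC : commutative Cadd.
Proof. by move=> x y; apply: C_eq => /=; ring. Qed.

Lemma Cadd0 : left_id C0 Cadd.
Proof. by move=> x; apply: C_eq => /=; ring. Qed.

Lemma CaddN : left_inverse C0 Copp Cadd.
Proof. by move=> x; apply: C_eq => /=; ring. Qed.

Lemma CmulA : associative Cmul.
Proof. by move=> x y z; apply: C_eq => /=; ring. Qed.

Lemma CmulC : commutative Cmul.
Proof. by move=> x y; apply: C_eq => /=; ring. Qed.

Lemma Cmul1 : left_id C1 Cmul.
Proof. by move=> x; apply: C_eq => /=; ring. Qed.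

Lemma CmulD : left_distributive Cmul Cadd.
Proof. by move=> x y z; apply: C_eq => /=; ring. Qed.

Lemma C1_neq0 : C1 != C0.
Proof. by apply/eqP => -[]; exact: R1_neq_R0. Qed.

HB.instance Definition _ := GRing.isZmodule.Build C CaddA CaddC Cadd0 CaddN.
HB.instance Definition _ :=
  GRing.Zmodule_isComNzRing.Build C CmulA CmulC Cmul1 CmulD C1_neq0.

Lemma CmulV (z : C) : z != C0 -> Cmul (Cinv z) z = C1.
Proof.
move=> /eqP z0; have n0 : Re z * Re z + Im z * Im z <> 0.
  move=> h; apply: z0; apply: C_eq => /=.
    by apply: Rsqr_0_uniq; rewrite /Rsqr; nra.
  by apply: Rsqr_0_uniq; rewrite /Rsqr; nra.
by apply: C_eq => /=; field.
Qed.

(** A total field inverse must fix 0. Both numerators of [Cinv C0] are 0, so the value given to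
    division by 0 does not matter. *)
Lemma CinvC0 : Cinv C0 = C0.
Proof. by apply: C_eq; rewrite /= /Rdiv ?Ropp_0 Rmult_0_l. Qed.

HB.instance Definition _ := GRing.ComNzRing_isField.Build C CmulV CinvC0.

Lemma CexpD (z w : C) : Cexp (Cadd z w) = Cmul (Cexp z) (Cexp w).
Proof.
by apply: C_eq; rewrite /= exp_plus ?cos_plus ?sin_plus; ring.
Qed.

Lemma Cexp0 : Cexp C0 = C1.
Proof. by apply: C_eq; rewrite /= exp_0 ?cos_0 ?sin_0; ring. Qed.

Definition half : C := mkC (/ 2) 0.

Lemma half_neq0 : half != C0.
Proof. by apply/eqP => -[] h; lra. Qed.

Lemma Cexp_real_inj (r s : R) : Cexp (mkC r 0) = Cexp (mkC s 0) -> r = s.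
Proof. by move=> [] /=; rewrite cos_0 !Rmult_1_r => /exp_inv. Qed.

End ComplexField.

(** * Trigonometric polynomials *)

Local Notation E := Cexp.

Lemma CaddE z w : Cadd z w = z + w. Proof. by []. Qed.

Lemma CsubE z w : Csub z w = z - w. Proof. by []. Qed.

Lemma CmulE z w : Cmul z w = z * w. Proof. by []. Qed.

Lemma CoppE z : Copp z = - z. Proof. by []. Qed.

Lemma CdivE z w : Cdiv z w = z / w. Proof. by []. Qed.

Lemma C0E : C0 = 0. Proof. by []. Qed.

Lemma C1E : C1 = 1. Proof. by []. Qed.

Definition CringE := (CsubE, CdivE, CaddE, CmulE, CoppE, C0E, C1E).

Lemma CexpDE z w : E (z + w) = E z * E w. Proof. exact: CexpD. Qed.

Lemma Cexp_neq0 z : E z != 0.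
Proof.
apply/eqP => e; have := CexpDE z (- z); rewrite subrr Cexp0 e mul0r => /eqP.
by rewrite (negbTE C1_neq0).
Qed.

Lemma CexpN z : E (- z) = (E z)^-1.
Proof.
apply: (mulfI (Cexp_neq0 z)); rewrite divff ?Cexp_neq0 //.
by rewrite -CexpDE subrr Cexp0.
Qed.

Lemma wbE z : wb z = half * (E z - (E z)^-1).
Proof. by rewrite /wb /Csinh !CringE CexpN mulrC. Qed.

Lemma wcE (g z : C) : wc g z = wb g. Proof. by []. Qed.

Lemma waE (g z : C) : wa g z = wb (z + g). Proof. by []. Qed.

Definition sinhE := (waE, wcE, wbE, CexpDE, CexpN, Cexp0).

Lemma wb0 : wb 0 = 0.
Proof. by rewrite !sinhE invr1 subrr mulr0. Qed.

Lemma wbN z : wb (- z) = - wb z.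
Proof. by rewrite !sinhE; field; rewrite Cexp_neq0 oner_eq0. Qed.

Lemma wbC x y : wb (x - y) = - wb (y - x).
Proof. by rewrite -wbN opprB. Qed.

(** Up to an invertible factor, [b (x - y)] is [e^(2x) - e^(2y)]. Interpolation points are therefore
    compared through [e^(2x)], the variable of the polynomials behind [trig]. *)
Lemma wb_eq0 x y : (wb (x - y) == 0) = (E x ^+ 2 == E y ^+ 2).
Proof.
have -> : wb (x - y) = half / (E x * E y) * (E x ^+ 2 - E y ^+ 2).
  by rewrite !sinhE; field; rewrite ?Cexp_neq0 ?oner_eq0.
rewrite !mulf_eq0 invr_eq0 mulf_eq0 !(negbTE (Cexp_neq0 _)) subr_eq0 orbF.
by rewrite (negbTE half_neq0).
Qed.

Section TrigonometricPolynomials.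

(* [f] is a combination of [e^(k z)] with [k = -n, -n + 2, ..., n]. *)
Definition trig (n : nat) (f : C -> C) :=
  exists2 p : {poly C}, (size p <= n.+1)%N
    & forall z, E z ^+ n * f z = p.[E z ^+ 2].

Lemma trig_ext n f h : f =1 h -> trig n f -> trig n h.
Proof. by move=> fh [p sp pE]; exists p => // z; rewrite -fh. Qed.

Lemma trigC c : trig 0 (fun=> c).
Proof. by exists c%:P; rewrite ?size_polyC ?leq_b1 // => z; rewrite hornerC mul1r. Qed.

Lemma trig0 n : trig n (fun=> 0).
Proof. by exists 0; rewrite ?size_poly0 // => z; rewrite horner0 mulr0. Qed.

Lemma trigM n m f h : trig n f -> trig m h -> trig (n + m) (fun z => f z * h z).
Proof.
move=> [p sp pE] [q sq qE]; exists (p * q) => [|z].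
  apply: leq_trans (size_polyMleq _ _) _.
  by rewrite -subn1 leq_subLR add1n -addnS -addSn leq_add.
by rewrite hornerM -pE -qE exprD; ring.
Qed.

Lemma trigD n f h : trig n f -> trig n h -> trig n (fun z => f z + h z).
Proof.
move=> [p sp pE] [q sq qE]; exists (p + q) => [|z].
  by rewrite (leq_trans (size_polyD _ _)) // geq_max sp.
by rewrite hornerD -pE -qE mulrDr.
Qed.

Lemma trigZ n c f : trig n f -> trig n (fun z => c * f z).
Proof. by move=> ?; rewrite -[n]add0n; apply: trigM => //; apply: trigC. Qed.

Lemma trigN n f : trig n f -> trig n (fun z => - f z).
Proof. by move=> /(trigZ (-1)); apply: trig_ext => z; rewrite mulN1r. Qed.

Lemma trigB n f h : trig n f -> trig n h -> trig n (fun z => f z - h z).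
Proof. by move=> tf /trigN; apply: trigD. Qed.

Lemma trig_wbl x : trig 1 (fun z => wb (z + x)).
Proof.
exists (half *: (E x *: 'X - (E x)^-1%:P)) => [|z].
  rewrite (leq_trans (size_scale_leq _ _)) // (leq_trans (size_polyD _ _)) //.
  rewrite geq_max size_polyN size_polyC (leq_trans (size_scale_leq _ _)) ?size_polyX //.
  by case: (_ == _).
rewrite hornerZ hornerD hornerN hornerZ hornerX !hornerC !sinhE.
by field; rewrite !Cexp_neq0 ?oner_eq0.
Qed.

Lemma trig_wbr x : trig 1 (fun z => wb (x - z)).
Proof.
by apply: trig_ext (trigN (trig_wbl (- x))) => z; rewrite [RHS]wbC.
Qed.

Lemma trig_war (g x : C) : trig 1 (fun z => wa g (x - z)).
Proof. by apply: trig_ext (trig_wbr (x + g)) => z; rewrite waE addrAC. Qed.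

Lemma trig_sum (I : Type) (r : seq I) (P : pred I) n (f : I -> C -> C) :
  (forall i, P i -> trig n (f i)) -> trig n (fun z => \sum_(i <- r | P i) f i z).
Proof.
move=> tf; elim: r => [|i r IH].
  by apply: trig_ext (trig0 n) => z; rewrite big_nil.
case Pi: (P i); last by apply: trig_ext IH => z; rewrite big_cons Pi.
by apply: trig_ext (trigD (tf _ Pi) IH) => z; rewrite big_cons Pi.
Qed.

Lemma trig_prod (I : Type) (r : seq I) (P : pred I) (d : I -> nat) (f : I -> C -> C) :
  (forall i, P i -> trig (d i) (f i)) ->
  trig (\sum_(i <- r | P i) d i) (fun z => \prod_(i <- r | P i) f i z).
Proof.
move=> tf; elim: r => [|i r IH].
  by rewrite big_nil; apply: trig_ext (trigC 1) => z; rewrite big_nil.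
rewrite big_cons; case Pi: (P i); last by apply: trig_ext IH => z; rewrite big_cons Pi.
by apply: trig_ext (trigM (tf _ Pi) IH) => z; rewrite big_cons Pi.
Qed.

(** Times [e^(nz)], [f] is a polynomial of degree at most [n] in [e^(2z)], and it has [n + 1]
    distinct roots [e^(2 x_i)]. *)
Lemma trig_uniqueness n f (x : 'I_n.+1 -> C) :
  trig n f -> (forall i j, i != j -> wb (x i - x j) != 0) ->
  (forall i, f (x i) = 0) -> forall z, f z = 0.
Proof.
move=> [p sp pE] xD fx0 z.
suff p0 : p = 0.
  by apply: (mulfI (expf_neq0 n (Cexp_neq0 z))); rewrite pE p0 horner0 mulr0.
apply: (@roots_geq_poly_eq0 _ _ [seq E (x i) ^+ 2 | i <- enum 'I_n.+1]).
- by apply/allP => _ /mapP[i _ ->]; rewrite /root -pE fx0 mulr0.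
- rewrite map_inj_uniq ?enum_uniq // => i j /eqP; rewrite -wb_eq0.
  by apply: contraTeq => /xD.
- by rewrite size_map size_enum_ord.
Qed.

End TrigonometricPolynomials.

(** * Cauchy-type matrices *)

Lemma prod_lift n (j : 'I_n.+1) (R : pred 'I_n.+1) (F : 'I_n.+1 -> C) :
  \prod_(k | R k) F k =
  (if R j then F j else 1) * \prod_(k | R (lift j k)) F (lift j k).
Proof. by rewrite big_mkcond (bigD1_ord j) //= -big_mkcond. Qed.

Section Matrices.
Variable g : C.

Definition ratio (u v : C) := wa g (u - v) / wb (u - v).

(** The weights [P] and [Q] stay free, so that [W], its minors at a frozen inhomogeneity and the
    matrix on all of [x_0, ..., x_L] are instances. Points are indexed by [nat], so that deleting
    one is composition with [bump]. *)
Definition kostov n (P Q x : nat -> C) : 'M[C]_n :=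
  \matrix_(i < n, j < n)
    if j == i then P i - Q i * \prod_(k < n | k != i) ratio (x i) (x k)
    else wb g / wb (x i - x j) *
         (Q j * \prod_(k < n | (k != i) && (k != j)) ratio (x j) (x k)).

Definition distinct n (x : nat -> C) :=
  forall i j, (i < n)%N -> (j < n)%N -> i != j -> wb (x i - x j) != 0.

Lemma eq_kostov n P Q x P' Q' x' :
  (forall i, (i < n)%N -> P i = P' i) -> (forall i, (i < n)%N -> Q i = Q' i) ->
  (forall i, (i < n)%N -> x i = x' i) ->
  kostov n P Q x = kostov n P' Q' x'.
Proof.
move=> eP eQ ex; apply/matrixP => i j; rewrite !mxE eP ?eQ ?ex //.
by congr (if _ then _ - _ * _ else _ * (_ * _)); apply: eq_bigr => k _; rewrite !ex.
Qed.

(** Column [j] is linear in the pair [(P j, Q j)], so [l j] factors out of it. *)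
Lemma det_kostov_scale n P Q x (l : nat -> C) :
  \det (kostov n (fun i => l i * P i) (fun i => l i * Q i) x) =
  \det (kostov n P Q x) * \prod_(i < n) l i.
Proof.
have -> : kostov n (fun i => l i * P i) (fun i => l i * Q i) x =
          kostov n P Q x *m diag_mx (\row_i l i).
  rewrite mul_mx_diag; apply/matrixP => i j; rewrite !mxE.
  by case: eqP => [->|_]; ring.
rewrite det_mulmx det_diag; congr (_ * _).
by apply: eq_bigr => i _; rewrite mxE.
Qed.

(** With [Q j = 0] only the diagonal entry [P j] of column [j] survives. In the complementary minor
    the factor [k = j] of each product is absorbed into the new [Q]. *)
Lemma det_kostov_col n P Q x (j : nat) : (j < n.+1)%N -> Q j = 0 ->
  \det (kostov n.+1 P Q x) =
  P j * \det (kostov n (P \o bump j)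
                (fun i => Q (bump j i) * ratio (x (bump j i)) (x j)) (x \o bump j)).
Proof.
move=> jn Qj; pose o := Ordinal jn.
rewrite (expand_det_col _ o) (bigD1 o) //= big1 ?addr0 => [|i io].
  rewrite mxE eqxx Qj mul0r subr0 /cofactor addnn -signr_odd odd_double mul1r.
  congr (_ * \det _); apply/matrixP => a b; rewrite !mxE (inj_eq lift_inj).
  have no c : (o != lift o c) = true by rewrite neq_lift.
  case: eqP => _; rewrite (prod_lift o) /= ?no /=.
    rewrite mulrA; congr (_ - _ * _ ).
    by apply: eq_bigl => k; rewrite (inj_eq lift_inj).
  congr (_ * _); rewrite mulrA; congr (_ * _).
  by apply: eq_bigl => k; rewrite !(inj_eq lift_inj).
by rewrite mxE eq_sym (negbTE io) Qj mul0r mulr0 mul0r.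
Qed.

Lemma trig_wb_prod (I : Type) (r : seq I) (m : I -> C) :
  trig (size r) (fun z => \prod_(i <- r) wb (z - m i)).
Proof.
rewrite -sum1_size; apply: trig_prod => i _; exact: trig_wbl.
Qed.

Lemma prod_neq0 n (P : pred 'I_n) (F : 'I_n -> C) :
  (forall k, P k -> F k != 0) -> \prod_(k | P k) F k != 0.
Proof. by move=> h; apply/prodf_neq0. Qed.

(** Both sides are trigonometric polynomials of degree [n] in [z], and they agree at the [n + 1]
    points [x_i]. *)
Lemma lagrange n (mus : seq C) (x : nat -> C) (z : C) :
  size mus = n -> distinct n.+1 x ->
  \prod_(m <- mus) wb (z - m) =
  \sum_(i < n.+1) \prod_(m <- mus) wb (x i - m)
     / \prod_(j < n.+1 | j != i) wb (x i - x j) * \prod_(j < n.+1 | j != i) wb (z - x j).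
Proof.
move=> sm xD; apply/eqP; rewrite -subr_eq0; apply/eqP.
have xD' (i j : 'I_n.+1) : i != j -> wb (x i - x j) != 0 by move=> ij; apply: xD.
pose f z := \prod_(m <- mus) wb (z - m) -
  \sum_(i < n.+1) \prod_(m <- mus) wb (x i - m)
     / \prod_(j < n.+1 | j != i) wb (x i - x j) * \prod_(j < n.+1 | j != i) wb (z - x j).
apply: (@trig_uniqueness n f (fun i => x i)) => // [|i].
  apply: trigB; first by rewrite -sm; apply: trig_wb_prod.
  apply: trig_sum => i _; apply: trigZ.
  suff: trig (\sum_(j < n.+1 | j != i) 1)%N (fun z => \prod_(j < n.+1 | j != i) wb (z - x j)).
    by rewrite sum1_card cardC1 card_ord.
  by apply: trig_prod => j _; apply: trig_wbl.
rewrite /f (bigD1 i) //= [X in _ - (_ + X)]big1 ?addr0 => [|k ki].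
  by rewrite divfK ?subrr //; apply: prod_neq0 => k ki; apply: xD'; rewrite eq_sym.
by rewrite [X in _ * X](bigD1 (P := fun j => j != k) i) ?(eq_sym i) //= subrr wb0 mul0r mulr0.
Qed.

(** For distinct points this is the residue at [z = x_i] of [prod_m b (z - m) / prod_j b (z - x_j)],
    and also the coefficient in the interpolation formula. *)
Definition residue n (mus : seq C) (x : nat -> C) (i : nat) :=
  \prod_(m <- mus) wb (x i - m) / \prod_(j < n | j != i :> nat) wb (x i - x j).

Lemma kostov_left_null n (mus : seq C) (x : nat -> C) (j : 'I_n.+1) :
  size mus = n -> distinct n.+1 x ->
  \sum_(i < n.+1) residue n.+1 mus x i *
     kostov n.+1 (fun i => \prod_(m <- mus) wa g (x i - m))
                 (fun i => \prod_(m <- mus) wb (x i - m)) x i j = 0.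
Proof.
move=> sm xD; pose r i := residue n.+1 mus x i.
have xD' (i k : 'I_n.+1) : i != k -> wb (x i - x k) != 0 by move=> ij; apply: xD.
have PE : \prod_(m <- mus) wa g (x j - m) =
    \sum_(i < n.+1) r i * \prod_(k < n.+1 | k != i) wa g (x j - x k).
  transitivity (\prod_(m <- mus) wb (x j + g - m)).
    by apply: eq_bigr => m _; rewrite waE addrAC.
  rewrite (lagrange _ sm xD); apply: eq_bigr => i _; congr (_ * _).
  by apply: eq_bigr => k _; rewrite waE addrAC.
have bj0 : \prod_(k < n.+1 | k != j) wb (x j - x k) != 0.
  by apply: prod_neq0 => k kj; apply: xD'; rewrite eq_sym.
have QE : \prod_(m <- mus) wb (x j - m) = r j * \prod_(k < n.+1 | k != j) wb (x j - x k).
  by rewrite /r /residue divfK.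
rewrite (bigD1 j) //= -/(r j) mxE eqxx PE mulrBr QE.
have -> : r j * \prod_(k < n.+1 | k != j) wb (x j - x k) *
      \prod_(k < n.+1 | k != j) ratio (x j) (x k) =
    r j * \prod_(k < n.+1 | k != j) wa g (x j - x k).
  rewrite -mulrA -big_split /=; congr (_ * _); apply: eq_bigr => k kj.
  by rewrite /ratio mulrCA divff ?mulr1 // xD' // eq_sym.
(* The term [i = j] of the interpolation formula cancels the subtracted part of the diagonal entry.
   Each other term cancels one off-diagonal entry. *)
rewrite mulr_sumr (bigD1 j) //= [X in X + _]addrAC subrr add0r.
rewrite -big_split /= big1 // => i ij.
rewrite mxE eq_sym (negbTE ij) -/(r i) QE.
rewrite (bigD1 (P := fun k => k != i) j) ?(eq_sym j) //= subrr.
rewrite (bigD1 (P := fun k => k != j) i) //=.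
have e : \prod_(k < n.+1 | (k != i) && (k != j)) wb (x j - x k) *
   \prod_(k < n.+1 | (k != i) && (k != j)) ratio (x j) (x k) =
   \prod_(k < n.+1 | (k != i) && (k != j)) wa g (x j - x k).
  rewrite -big_split /=; apply: eq_bigr => k /andP[_ kj].
  by rewrite /ratio mulrCA divff ?mulr1 // xD' // eq_sym.
rewrite -e waE add0r [wb (x i - x j)]wbC.
have -> : \prod_(k < n.+1 | (k != j) && (k != i)) wb (x j - x k) =
    \prod_(k < n.+1 | (k != i) && (k != j)) wb (x j - x k).
  by apply: eq_bigl => k; rewrite andbC.
have ji : wb (x j - x i) != 0 by apply: xD'; rewrite eq_sym.
by field; rewrite oppr_eq0.
Qed.

(** If all residues vanished, the [n + 1] distinct values [e^(2 x_i)] would lie among the [n] values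
    [e^(2m)]. Hence the left null vector is nonzero and the determinant vanishes. *)
Lemma residue_neq0 n (mus : seq C) (x : nat -> C) :
  size mus = n -> distinct n.+1 x -> exists i : 'I_n.+1, residue n.+1 mus x i != 0.
Proof.
move=> sm xD; apply/existsP; apply: contraT; rewrite negb_exists => /forallP r0.
have xmus (i : 'I_n.+1) : E (x i) ^+ 2 \in [seq E m ^+ 2 | m <- mus].
  have := r0 i; rewrite negbK /residue mulf_eq0 invr_eq0 orbC.
  rewrite (negbTE (prod_neq0 _)) /=; last first.
    by move=> k ki; apply: xD => //; rewrite eq_sym.
  rewrite prodf_seq_eq0 => /hasP[m mm]; rewrite wb_eq0 /= => /eqP ->.
  by apply/mapP; exists m.
have := @uniq_leq_size _ [seq E (x i) ^+ 2 | i : 'I_n.+1 <- enum 'I_n.+1] [seq E m ^+ 2 | m <- mus].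
rewrite (size_map _ mus) (size_map _ (enum 'I_n.+1)) size_enum_ord sm ltnn; apply.
- rewrite map_inj_uniq ?enum_uniq // => i j /eqP; rewrite -wb_eq0.
  by apply: contraTeq => ij; apply: xD.
- by move=> _ /mapP[i _ ->]; apply: xmus.
Qed.

Lemma det_kostov_eq0 n (mus : seq C) (x : nat -> C) :
  size mus = n -> distinct n.+1 x ->
  \det (kostov n.+1 (fun i => \prod_(m <- mus) wa g (x i - m))
                    (fun i => \prod_(m <- mus) wb (x i - m)) x) = 0.
Proof.
move=> sm xD; apply/eqP/det0P.
exists (\row_i residue n.+1 mus x i).
  have [i] := residue_neq0 sm xD; apply: contraNneq => /rowP/(_ i).
  by rewrite !mxE => ->.
apply/rowP => j; rewrite !mxE -[RHS](kostov_left_null j sm xD).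
by apply: eq_bigr => i _; rewrite mxE.
Qed.

End Matrices.

(** * The six-vertex operators *)

Lemma Csum_map (T : Type) (f : T -> C) (l : list T) :
  Csum (List.map f l) = \sum_(s <- l) f s.
Proof. by elim: l => [|a l IH]; rewrite ?big_nil // big_cons -IH. Qed.

Lemma configsS n :
  configs n.+1 = map (cons false) (configs n) ++ map (cons true) (configs n).
Proof. by []. Qed.

Section SixVertexOperators.
Variable g : C.

(** The second column of the monodromy matrix: [a = false] gives [B(x)], [a = true] gives [D(x)].
    Adding a site on the left multiplies from the left, so this column is closed under the recursion
    on sites. *)
Definition monodromy (x : C) (mus : seq C) (a : bool) (v : seq bool -> C) : seq bool -> C :=
  fun sp => \sum_(s <- configs (size mus)) Tent g x mus a sp s true * v s.

Local Notation op := monodromy.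
Local Notation tl b v := (fun s => v (b :: s)).

Lemma applyB_monodromy x mus v : applyB g x mus v = op x mus false v.
Proof. by apply: funext => sp; rewrite /applyB Csum_map. Qed.

Lemma monodromyD x mus a v w sp :
  op x mus a (fun s => v s + w s) sp = op x mus a v sp + op x mus a w sp.
Proof. by rewrite -big_split; apply: eq_bigr => s _; rewrite mulrDr. Qed.

Lemma monodromyZ x mus a c v sp :
  op x mus a (fun s => c * v s) sp = c * op x mus a v sp.
Proof. by rewrite [RHS]mulr_sumr; apply: eq_bigr => s _; rewrite mulrCA. Qed.

Lemma monodromy_nil x a v : op x [::] a v [::] = if a then v [::] else 0.
Proof.
by rewrite /op big_cons big_nil addr0 /= CringE; case: a; rewrite /= ?CringE ?mul1r ?mul0r.
Qed.

Lemma monodromy_size_mismatch x a v :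
  (forall b sp, op x [::] a v (b :: sp) = 0) *
  (forall mu mus, op x (mu :: mus) a v [::] = 0).
Proof.
split=> *; rewrite /op big1 // => s _; rewrite (_ : Tent _ _ _ _ _ _ _ = 0) ?mul0r //.
Qed.

Lemma monodromy_cons x mu mus a b v sp : op x (mu :: mus) a v (b :: sp) =
  Rent g (x - mu) a b false false * op x mus false (tl false v) sp +
  Rent g (x - mu) a b true false * op x mus true (tl false v) sp +
  (Rent g (x - mu) a b false true * op x mus false (tl true v) sp +
  Rent g (x - mu) a b true true * op x mus true (tl true v) sp).
Proof.
rewrite {1}/op configsS big_cat !big_map /= !mulr_sumr -!big_split.
by apply: eq_bigr => s _; rewrite !CringE /=; ring.
Qed.

(* Both forms serve to rewrite: the second one under the next operator. *)
Lemma monodromy_BF x mu mus v :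
  (forall sp, op x (mu :: mus) false v (false :: sp) =
     wa g (x - mu) * op x mus false (tl false v) sp) *
  (tl false (op x (mu :: mus) false v) = fun sp =>
     wa g (x - mu) * op x mus false (tl false v) sp).
Proof. by split; [move=> sp|apply: funext => sp]; rewrite monodromy_cons /= !CringE; ring. Qed.

Lemma monodromy_BT x mu mus v :
  (forall sp, op x (mu :: mus) false v (true :: sp) =
     wb g * op x mus true (tl false v) sp + wb (x - mu) * op x mus false (tl true v) sp) *
  (tl true (op x (mu :: mus) false v) = fun sp =>
     wb g * op x mus true (tl false v) sp + wb (x - mu) * op x mus false (tl true v) sp).
Proof. by split; [move=> sp|apply: funext => sp]; rewrite monodromy_cons /= !CringE wcE; ring. Qed.

Lemma monodromy_DF x mu mus v :
  (forall sp, op x (mu :: mus) true v (false :: sp) =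
     wb (x - mu) * op x mus true (tl false v) sp + wb g * op x mus false (tl true v) sp) *
  (tl false (op x (mu :: mus) true v) = fun sp =>
     wb (x - mu) * op x mus true (tl false v) sp + wb g * op x mus false (tl true v) sp).
Proof. by split; [move=> sp|apply: funext => sp]; rewrite monodromy_cons /= !CringE wcE; ring. Qed.

Lemma monodromy_DT x mu mus v :
  (forall sp, op x (mu :: mus) true v (true :: sp) =
     wa g (x - mu) * op x mus true (tl true v) sp) *
  (tl true (op x (mu :: mus) true v) = fun sp =>
     wa g (x - mu) * op x mus true (tl true v) sp).
Proof. by split; [move=> sp|apply: funext => sp]; rewrite monodromy_cons /= !CringE; ring. Qed.

(** Here [X], [Y], [X'], [Y'] stand for [B(x)D(y)], [D(x)B(y)], [B(y)D(x)], [D(y)B(x)]. The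
    conditions on [f2] and [f4] say that [b (x - y)] times the combination is [f1] times the first
    exchange relation minus [f3] times the second. *)
Lemma relations_elim x y X Y X' Y' f1 f2 f3 f4 :
  wb (x - y) != 0 ->
  wb (x - y) * X + wb g * Y = wa g (x - y) * Y' ->
  wb (y - x) * X' + wb g * Y' = wa g (y - x) * Y ->
  wb (x - y) * f2 = f1 * wb g + f3 * wa g (y - x) ->
  wb (x - y) * f4 = - (f1 * wa g (x - y)) - f3 * wb g ->
  f1 * X + f2 * Y + f3 * X' + f4 * Y' = 0.
Proof.
move=> b0 h1 h2 e2 e4; apply: (mulfI b0); rewrite mulr0.
transitivity (f1 * (wb (x - y) * X + wb g * Y - wa g (x - y) * Y')
              - f3 * (wb (y - x) * X' + wb g * Y' - wa g (y - x) * Y)).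
  rewrite !mulrDr ![wb (x - y) * (_ * _)]mulrA e2 e4 (wbC y x); ring.
by rewrite h1 h2 !subrr !mulr0 subrr.
Qed.

(** The relations need a joint induction on the sites: the steps for [BB] and [DD] use both [BD]
    relations, and the step for [BD] uses [BB] and [DD]. *)
Definition commutation x y mus := forall v sp,
  [/\ op x mus false (op y mus false v) sp = op y mus false (op x mus false v) sp,
      op x mus true (op y mus true v) sp = op y mus true (op x mus true v) sp,
      wb (x - y) * op x mus false (op y mus true v) sp +
        wb g * op x mus true (op y mus false v) sp =
        wa g (x - y) * op y mus true (op x mus false v) sp &
      wb (y - x) * op y mus false (op x mus true v) sp +
        wb g * op y mus true (op x mus false v) sp =
        wa g (y - x) * op x mus true (op y mus false v) sp].

Lemma eq_by_combination (z w e d t : C) : e = 0 -> d = 0 -> z - w = e + d * t -> z = w.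
Proof. by move=> -> -> /eqP; rewrite mul0r addr0 subr_eq0 => /eqP. Qed.

Ltac trig_identity :=
  rewrite !sinhE; field; rewrite ?Cexp_neq0 ?oner_eq0 //.

Lemma commutation_sym x y mus : commutation x y mus -> commutation y x mus.
Proof. by move=> h v sp; have [] := h v sp. Qed.

Lemma commutation_step x y mu mus v sp : wb (x - y) != 0 -> commutation x y mus ->
  wb (x - y) * op x (mu :: mus) false (op y (mu :: mus) true v) sp +
        wb g * op x (mu :: mus) true (op y (mu :: mus) false v) sp =
        wa g (x - y) * op y (mu :: mus) true (op x (mu :: mus) false v) sp.
Proof.
move=> b0 IH; case: sp => [|[] sp]; rewrite ?monodromy_size_mismatch ?mulr0 ?addr0 //.
  rewrite monodromy_BT monodromy_DT monodromy_DT !monodromy_DF !monodromy_DT !monodromy_BT.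
  rewrite !(monodromyD, monodromyZ).
  have [_ DD _ _] := IH (tl false v) sp; have [_ _ h1 h2] := IH (tl true v) sp.
  (* Once [D(x)] and [D(y)] commute, their product on [tl false v] has total coefficient [dd], which
     vanishes. The rest is a combination of the exchange relations on the other sites. The case
     below is the same with [BB]. *)
  have dd : wb (x - y) * wb g * wb (y - mu) + wb g * wa g (x - mu) * wb g
            - wa g (x - y) * wa g (y - mu) * wb g = 0 by trig_identity.
  have /(_ ltac:(trig_identity) ltac:(trig_identity)) e :=
    @relations_elim x y _ _ _ _ (wb (x - y) * wb (x - mu) * wa g (y - mu))
    (wb (x - y) * wb g ^+ 2 + wb g * wa g (x - mu) * wb (y - mu)) 0
    (- (wa g (x - y) * wa g (y - mu) * wb (x - mu))) b0 h1 h2.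
  apply: (eq_by_combination (t := op y mus true (op x mus true (tl false v)) sp) e dd).
  by rewrite DD; ring.
rewrite monodromy_BF monodromy_DF monodromy_DF !monodromy_DF !monodromy_BF !monodromy_BT.
rewrite !(monodromyD, monodromyZ).
have [BB _ _ _] := IH (tl true v) sp; have [_ _ h1 h2] := IH (tl false v) sp.
have bb : wb (x - y) * wa g (x - mu) * wb g + wb g ^+ 2 * wb (y - mu)
          - wa g (x - y) * wb g * wb (x - mu) = 0 by trig_identity.
have /(_ ltac:(trig_identity) ltac:(trig_identity)) e :=
    @relations_elim x y _ _ _ _
  (wb (x - y) * wa g (x - mu) * wb (y - mu) + wb g ^+ 3)
  (wb g * wb (x - mu) * wa g (y - mu)) (- (wa g (x - y) * wb g ^+ 2))
  (- (wa g (x - y) * wb (y - mu) * wa g (x - mu))) b0 h1 h2.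
apply: (eq_by_combination (t := op y mus false (op x mus false (tl true v)) sp) e bb).
by rewrite BB; ring.
Qed.

(* Only [wb (x - y) != 0] is needed: the exchange relations, read as expressions
   of [B(x)D(y)] in terms of [D(x)B(y)] and [D(y)B(x)], close under adding a
   site, so no division by [wa g (x - y)] occurs. *)
Lemma monodromy_commutation x y mus : wb (x - y) != 0 -> commutation x y mus.
Proof.
move=> b0; have b0' : wb (y - x) != 0 by rewrite wbC oppr_eq0.
elim: mus => [v [|b sp]|mu mus IH v sp].
- by split; rewrite !monodromy_nil ?mulr0 ?addr0.
- by split; rewrite !monodromy_size_mismatch ?mulr0 ?addr0.
split; last 2 first.
- exact: commutation_step.
- by apply: commutation_step => //; apply: commutation_sym.
- case: sp => [|[] sp]; first by rewrite !monodromy_size_mismatch.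
    rewrite !monodromy_BT !monodromy_BF !(monodromyD, monodromyZ).
    have [BB _ _ _] := IH (tl true v) sp; have [_ _ h1 h2] := IH (tl false v) sp.
    have /(_ ltac:(trig_identity) ltac:(trig_identity)) e :=
    @relations_elim x y _ _ _ _ (wb g * wb (x - mu)) (wb g * wa g (y - mu))
      (- (wb g * wb (y - mu))) (- (wb g * wa g (x - mu))) b0 h1 h2.
    by apply: (eq_by_combination (t := 0) e (erefl 0)); rewrite BB; ring.
  have [BB _ _ _] := IH (tl false v) sp.
  by rewrite !monodromy_BF !monodromyZ BB; ring.
- case: sp => [|[] sp]; first by rewrite !monodromy_size_mismatch.
    have [_ DD _ _] := IH (tl true v) sp.
    by rewrite !monodromy_DT !monodromyZ DD; ring.
  rewrite !monodromy_DF !monodromy_DT !(monodromyD, monodromyZ).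
  have [_ DD _ _] := IH (tl false v) sp; have [_ _ h1 h2] := IH (tl true v) sp.
  have /(_ ltac:(trig_identity) ltac:(trig_identity)) e :=
    @relations_elim x y _ _ _ _ (wb g * wa g (y - mu)) (wb g * wb (x - mu))
    (- (wb g * wa g (x - mu))) (- (wb g * wb (y - mu))) b0 h1 h2.
  by apply: (eq_by_combination (t := 0) e (erefl 0)); rewrite DD; ring.
Qed.

(** * Products of [B] operators and the Korepin recursion *)

Definition Bprod (mus xs : seq C) (v : seq bool -> C) : seq bool -> C :=
  foldr (fun x => op x mus false) v xs.

Lemma Zpf_Bprod mus xs :
  Zpf g mus xs = Bprod mus xs (vac (size mus)) (nseq (size mus) true).
Proof.
have tE : List.repeat true (length mus) = nseq (size mus) true by elim: mus => //= ? ? ->.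
rewrite /Zpf tE; congr (_ _).
by elim: xs => //= x xs ->; rewrite applyB_monodromy.
Qed.

Lemma Bprod_front mus l y r v : (forall u, u \in l -> wb (u - y) != 0) ->
  Bprod mus (l ++ y :: r) v = Bprod mus (y :: l ++ r) v.
Proof.
elim: l => //= u l IH h; rewrite IH => [|z zl]; last by apply: h; rewrite inE zl orbT.
apply: funext => sp /=.
by have [] := monodromy_commutation mus (h u (mem_head _ _)) (Bprod mus (l ++ r) v) sp.
Qed.

(** If the first site ends in [v_1], conservation of arrows leaves only the vertex [a] there for
    every [B]. *)
Lemma Bprod_false mu mus xs v : tl false (Bprod (mu :: mus) xs v) =
  fun sp => \prod_(x <- xs) wa g (x - mu) * Bprod mus xs (tl false v) sp.
Proof.
elim: xs => [|x xs IH]; first by apply: funext => sp; rewrite big_nil mul1r.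
by apply: funext => sp; rewrite big_cons /= monodromy_BF IH monodromyZ; ring.
Qed.

Lemma Bprod_true mu mus x xs v sp : Bprod (mu :: mus) (x :: xs) v (true :: sp) =
  wb g * \prod_(x <- xs) wa g (x - mu) * op x mus true (Bprod mus xs (tl false v)) sp +
  wb (x - mu) * op x mus false (tl true (Bprod (mu :: mus) xs v)) sp.
Proof. by rewrite /= monodromy_BT Bprod_false monodromyZ mulrA. Qed.

(** By [vT] the first site starts in [v_1], and it must end in [v_2]. Exactly one [B] flips it, with
    the constant weight [c], and each of the others contributes one weight [a] or [b]. Hence the
    degree is one less than the number of operators. *)
Lemma trig_Bprod mus x xs v sp : tl true v = (fun=> 0) ->
  trig (size xs) (fun mu => Bprod (mu :: mus) (x :: xs) v (true :: sp)).
Proof.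
move=> vT; elim: xs x sp => [|y xs IH] x sp.
  apply: trig_ext (trigC (wb g * op x mus true (tl false v) sp)) => mu.
  rewrite Bprod_true big_nil mulr1 /= vT.
  by rewrite [op _ _ false _ _]big1 ?mulr0 ?addr0 // => s _; rewrite mulr0.
apply: (@trig_ext _ (fun mu =>
   wb g * op x mus true (Bprod mus (y :: xs) (tl false v)) sp
     * \prod_(x <- y :: xs) wa g (x - mu)
   + wb (x - mu) * op x mus false (tl true (Bprod (mu :: mus) (y :: xs) v)) sp)).
  by move=> mu; rewrite Bprod_true; ring.
apply: trigD.
  apply: trigZ; rewrite -sum1_size; apply: trig_prod => i _; exact: trig_war.
apply: (@trigM 1 (size xs)); first exact: trig_wbr.
by apply: trig_sum => s _; apply: trigZ; apply: IH.
Qed.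

Lemma monodromy_true_nseq x mus v :
  op x mus true v (nseq (size mus) true) =
  \prod_(m <- mus) wa g (x - m) * v (nseq (size mus) true).
Proof.
elim: mus v => [|mu mus IH] v; first by rewrite monodromy_nil big_nil mul1r.
by rewrite monodromy_DT IH big_cons mulrA.
Qed.

Lemma vacS n : (tl false (vac n.+1) = vac n) * (tl true (vac n.+1) = (fun=> 0)).
Proof.
rewrite /vac; split; apply: funext => s.
  by case: List.list_eq_dec => [[->]|h]; case: List.list_eq_dec => // h'; case: h; rewrite h'.
by case: List.list_eq_dec.
Qed.

Lemma trig_Zpf mus x xs : trig (size xs) (fun mu => Zpf g (mu :: mus) (x :: xs)).
Proof.
apply: trig_ext (trig_Bprod mus x xs (nseq (size mus) true) (vacS (size mus)).2) => mu.
by rewrite Zpf_Bprod.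
Qed.

Lemma Zpf_front mus l y r : (forall u, u \in l -> wb (u - y) != 0) ->
  Zpf g mus (l ++ y :: r) = Zpf g mus (y :: l ++ r).
Proof. by move=> h; rewrite !Zpf_Bprod Bprod_front. Qed.

(** At [mu_1 = x] the weight [b] vanishes, so the leftmost [B] must flip the first site. On the
    other sites it then acts as [D(x)], which is diagonal on the all-[v_2] row. *)
Lemma Zpf_frozen x mus xs :
  Zpf g (x :: mus) (x :: xs) =
  wb g * \prod_(u <- xs) wa g (u - x) * \prod_(m <- mus) wa g (x - m) * Zpf g mus xs.
Proof.
rewrite !Zpf_Bprod Bprod_true subrr wb0 mul0r addr0 monodromy_true_nseq vacS; ring.
Qed.

Lemma Zpf_nil : Zpf g [::] [::] = 1.
Proof. by []. Qed.

End SixVertexOperators.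

(** * The first determinant *)

Section PartitionFunction.
Variable g : C.

Definition full_matrix n (mus : seq C) (y : nat -> C) : 'M[C]_n :=
  kostov g n (fun i => \prod_(m <- mus) wa g (y i - m))
             (fun i => \prod_(m <- mus) wb (y i - m)) y.

(** The point [y 0] is not one of the [n] points: the factors [k = 0] of the products in [W] are
    moved into the weight [Q]. *)
Definition W_matrix n (mus : seq C) (y : nat -> C) : 'M[C]_n :=
  kostov g n (fun i => \prod_(m <- mus) wa g (y i.+1 - m))
    (fun i => \prod_(m <- mus) wb (y i.+1 - m) * ratio g (y i.+1) (y 0))
    (fun i => y i.+1).

Lemma trig_det n (A : C -> 'M[C]_n) :
  (forall i j, trig 1 (fun z => A z i j)) -> trig n (fun z => \det (A z)).
Proof.
move=> tA; apply: trig_sum => s _; apply: trigZ.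
have := @trig_prod _ (index_enum 'I_n) xpredT (fun=> 1%N) (fun i z => A z i (s i)).
by rewrite sum1_card card_ord; apply=> i _; apply: tA.
Qed.

Lemma trig_W_matrix n mus y : trig n (fun mu => \det (W_matrix n (mu :: mus) y)).
Proof.
apply: trig_det => i j.
have [<-|ij] := eqVneq j i.
  apply: (@trig_ext _ (fun mu => \prod_(m <- mus) wa g (y j.+1 - m) * wa g (y j.+1 - mu)
    - \prod_(m <- mus) wb (y j.+1 - m) * ratio g (y j.+1) (y 0) *
      \prod_(k < n | k != j) ratio g (y j.+1) (y k.+1) * wb (y j.+1 - mu))).
    by move=> mu; rewrite mxE eqxx !big_cons; ring.
  by apply: trigB; apply: trigZ; [apply: trig_war|apply: trig_wbr].
apply: (@trig_ext _ (fun mu => wb g / wb (y i.+1 - y j.+1) *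
   (\prod_(m <- mus) wb (y j.+1 - m) * ratio g (y j.+1) (y 0) *
      \prod_(k < n | (k != i) && (k != j)) ratio g (y j.+1) (y k.+1)) * wb (y j.+1 - mu))).
  by move=> mu; rewrite mxE (negbTE ij) !big_cons; ring.
by apply: trigZ; apply: trig_wbr.
Qed.

Lemma ltn_bump n j a : (a < n)%N -> (bump j a < n.+1)%N.
Proof. by move=> an; rewrite ltnS /bump (leq_trans _ an) // -(add1n a) leq_add2r leq_b1. Qed.

Lemma distinct_bump n y j : distinct n.+1 y -> distinct n (y \o bump j).
Proof.
move=> yD a b an bn ab; apply: yD; rewrite ?ltn_bump //.
by rewrite (inj_eq (can_inj (bumpK j))).
Qed.

Lemma map_bump (y : nat -> C) n j : (j < n.+1)%N ->
  [seq (y \o bump j.+1) k | k <- iota 1 n] =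
  [seq y k | k <- iota 1 j] ++ [seq y k | k <- iota j.+2 (n - j)].
Proof.
rewrite ltnS => jn; rewrite -{1}(subnKC jn) iotaD map_cat add1n; congr (_ ++ _).
  apply/eq_in_map => k; rewrite mem_iota add1n => /andP[_ kj] /=.
  by rewrite /bump leqNgt kj.
rewrite -[j.+2]add1n iotaDl -map_comp; apply/eq_in_map => k.
by rewrite mem_iota => /andP[jk _] /=; rewrite /bump jk.
Qed.

Lemma prod_iota n (F : nat -> C) : \prod_(k <- iota 1 n) F k = \prod_(k < n) F k.+1.
Proof. by rewrite -{1}[n]subn0 -subSS -/(index_iota 1 n.+1) big_add1 big_mkord. Qed.

(** With the denominators cleared, both sides are trigonometric polynomials in the first
    inhomogeneity, of degree the size of the matrix, and are compared at all the points [y i]. *)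
Lemma det_W_matrix n mus y : size mus = n -> distinct n.+1 y ->
  \det (W_matrix n mus y) * \prod_(k < n) wb (y 0%N - y k.+1) =
  Zpf g mus [seq y k | k <- iota 1 n] * \prod_(m <- mus) wb (y 0%N - m).
Proof.
elim: n mus y => [[] // y _ _|n IH [//|mu mus] y [sm] yD].
  by rewrite det_mx00 big_ord0 Zpf_nil big_nil.
apply/eqP; rewrite -subr_eq0; apply/eqP.
pose f z := \det (W_matrix n.+1 (z :: mus) y) * \prod_(k < n.+1) wb (y 0%N - y k.+1)
  - Zpf g (z :: mus) [seq y k | k <- iota 1 n.+1] * \prod_(m <- z :: mus) wb (y 0%N - m).
have yD' (i j : 'I_n.+2) : i != j -> wb (y i - y j) != 0 by move=> ij; apply: yD.
apply: (@trig_uniqueness n.+1 f (fun i => y i)) => // [|i].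
  apply: trigB.
    rewrite -{1}[n.+1]addn0; apply: trigM; [exact: trig_W_matrix|exact: trigC].
  rewrite -{1}addn1; apply: trigM.
    by have := @trig_Zpf g mus (y 1%N) [seq y k | k <- iota 2 n]; rewrite size_map size_iota.
  apply: (@trig_ext _ (fun z => \prod_(m <- mus) wb (y 0%N - m) * wb (y 0%N - z))).
    by move=> z; rewrite big_cons mulrC.
  by apply: trigZ; apply: trig_wbr.
apply/eqP; rewrite subr_eq0; apply/eqP.
case: (unliftP ord0 i) => [j|] -> {i} /=; last first.
  (* Node [y 0]: the new factor [b] of [Q] cancels the denominator of [ratio]. Both weights then
     carry [a (y_i - y_0)], and scaling it out leaves a singular matrix with one inhomogeneity fewer
     than points. *)
  rewrite [X in _ = _ * X]big_cons subrr wb0 mul0r mulr0.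
  rewrite /W_matrix (@eq_kostov g n.+1 _ _ _
     (fun i => wa g (y i.+1 - y 0%N) * \prod_(m <- mus) wa g (y i.+1 - m))
     (fun i => wa g (y i.+1 - y 0%N) * \prod_(m <- mus) wb (y i.+1 - m))
     (fun i => y i.+1)) //.
  - rewrite det_kostov_scale det_kostov_eq0 ?mul0r // => a b an bn ab.
    exact: yD.
  - by move=> a an; rewrite big_cons.
  - move=> a an; rewrite big_cons /ratio; field.
    exact: yD.
rewrite /bump leq0n add1n.
rewrite (@det_kostov_col g _ _ _ _ j) ?ltn_ord //; last first.
  by rewrite big_cons subrr wb0 !mul0r.
rewrite (@eq_kostov g n _ _ _
   (fun i => wa g ((y \o bump j.+1) i.+1 - y j.+1) *
             \prod_(m <- mus) wa g ((y \o bump j.+1) i.+1 - m))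
   (fun i => wa g ((y \o bump j.+1) i.+1 - y j.+1) *
             (\prod_(m <- mus) wb ((y \o bump j.+1) i.+1 - m)
              * ratio g ((y \o bump j.+1) i.+1) ((y \o bump j.+1) 0%N)))
   (fun i => (y \o bump j.+1) i.+1)); first last.
- by move=> a an /=; rewrite bumpS.
- move=> a an /=; rewrite bumpS big_cons /ratio.
  have bn : ((bump j a).+1 < n.+2)%N by rewrite ltnS ltn_bump.
  field; apply/andP; split; apply: yD => //; first by rewrite ltnS.
  by rewrite eqSS eq_sym neq_bump.
- by move=> a an /=; rewrite bumpS big_cons.
rewrite det_kostov_scale -/(W_matrix n mus (y \o bump j.+1)).
have -> : y 1%N :: [seq y k | k <- iota 2 n] =
    [seq y k | k <- iota 1 j] ++ y j.+1 :: [seq y k | k <- iota j.+2 (n - j)].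
  rewrite -[LHS]/[seq y k | k <- iota 1 n.+1] -{1}(subnKC (leq_ord j)) -addnS iotaD.
  by rewrite map_cat add1n.
rewrite Zpf_front; last first.
  move=> u /mapP[k]; rewrite mem_iota add1n => /andP[_ kj] ->{u}.
  have jn : (j.+1 < n.+2)%N by rewrite ltnS ltn_ord.
  by apply: yD => //; [apply: ltn_trans jn|rewrite ltn_eqF].
rewrite Zpf_frozen -map_bump ?ltn_ord // big_map prod_iota.
rewrite (bigD1_ord j) //=.
under [X in _ * (_ * X)]eq_bigr => k _ do rewrite -bumpS -[y (bump _ _)]/((y \o bump j.+1) k.+1).
have := IH mus (y \o bump j.+1) sm (@distinct_bump n.+1 y j.+1 yD).
rewrite -[(y \o bump j.+1) 0%N]/(y 0%N) => e.
transitivity (\det (W_matrix n mus (y \o bump j.+1)) *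
   \prod_(k < n) wb (y 0%N - (y \o bump j.+1) k.+1) *
   (\prod_(m <- y j.+1 :: mus) wa g (y j.+1 - m) *
   \prod_(i < n) wa g ((y \o bump j.+1) i.+1 - y j.+1) * wb (y 0%N - y j.+1))).
  ring.
by rewrite e !big_cons subrr waE add0r; ring.
Qed.

End PartitionFunction.

(** * The second determinant *)

Section ExponentialPolynomials.

(* Unlike [trig n], closed under sums of terms of different parity, such as those
   the constant weight [c] produces. *)
Definition exppoly (f : C -> C) :=
  exists n, exists p : {poly C}, forall z, E z ^+ n * f z = p.[E z].

Lemma exppoly_ext f h : f =1 h -> exppoly f -> exppoly h.
Proof. by move=> fh [n [p pE]]; exists n, p => z; rewrite -fh. Qed.

Lemma exppolyC c : exppoly (fun=> c).
Proof. by exists 0%N, c%:P => z; rewrite hornerC mul1r. Qed.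

Lemma exppolyM f h : exppoly f -> exppoly h -> exppoly (fun z => f z * h z).
Proof.
move=> [n [p pE]] [m [q qE]]; exists (n + m)%N, (p * q) => z.
by rewrite hornerM -pE -qE exprD; ring.
Qed.

Lemma exppolyD f h : exppoly f -> exppoly h -> exppoly (fun z => f z + h z).
Proof.
move=> [n [p pE]] [m [q qE]]; exists (n + m)%N, ('X^m * p + 'X^n * q) => z.
by rewrite hornerD !hornerM !hornerXn -pE -qE exprD; ring.
Qed.

Lemma exppolyZ c f : exppoly f -> exppoly (fun z => c * f z).
Proof. by apply: exppolyM; apply: exppolyC. Qed.

Lemma exppolyB f h : exppoly f -> exppoly h -> exppoly (fun z => f z - h z).
Proof.
move=> ef eh; apply: exppolyD => //.
by apply: exppoly_ext (exppolyZ (-1) eh) => z; rewrite mulN1r.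
Qed.

Lemma exppoly_sum (I : Type) (r : seq I) (P : pred I) (f : I -> C -> C) :
  (forall i, exppoly (f i)) -> exppoly (fun z => \sum_(i <- r | P i) f i z).
Proof.
move=> ef; elim: r => [|i r IH].
  by apply: exppoly_ext (exppolyC 0) => z; rewrite big_nil.
case Pi: (P i); last by apply: exppoly_ext IH => z; rewrite big_cons Pi.
by apply: exppoly_ext (exppolyD (ef i) IH) => z; rewrite big_cons Pi.
Qed.

Lemma exppoly_prod (I : Type) (r : seq I) (P : pred I) (f : I -> C -> C) :
  (forall i, exppoly (f i)) -> exppoly (fun z => \prod_(i <- r | P i) f i z).
Proof.
move=> ef; elim: r => [|i r IH].
  by apply: exppoly_ext (exppolyC 1) => z; rewrite big_nil.
case Pi: (P i); last by apply: exppoly_ext IH => z; rewrite big_cons Pi.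
by apply: exppoly_ext (exppolyM (ef i) IH) => z; rewrite big_cons Pi.
Qed.

Lemma trig_exppoly n f : trig n f -> exppoly f.
Proof.
move=> [p _ pE]; exists n, (p \Po 'X^2) => z.
by rewrite horner_comp hornerXn pE.
Qed.

Lemma exppoly_det n (A : C -> 'M[C]_n) :
  (forall i j, exppoly (fun z => A z i j)) -> exppoly (fun z => \det (A z)).
Proof.
by move=> eA; apply: exppoly_sum => s; apply: exppolyZ; apply: exppoly_prod => i.
Qed.

(** The values [e^k] for natural [k] already give more distinct roots than the degree allows. *)
Lemma poly_exp_eq0 (p : {poly C}) : (forall z, p.[E z] = 0) -> p = 0.
Proof.
move=> p0; pose e k := E (mkC (Raxioms.INR k) Rdefinitions.R0).
apply: (@roots_geq_poly_eq0 _ p [seq e k | k <- iota 0 (size p)]).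
- by apply/allP => _ /mapP[k _ ->]; rewrite /root p0.
- rewrite map_inj_uniq ?iota_uniq // => i j /Cexp_real_inj.
  exact: RIneq.INR_eq.
- by rewrite size_map size_iota.
Qed.

Lemma exppoly_cancel f (x : C) : exppoly f ->
  (forall z, f z * wb (x - z) = 0) -> forall z, f z = 0.
Proof.
move=> [n [p pE]] fx0 z.
(* Up to the factor [half], [q] at [e^t] is [e^t b (x - t)]. It is a nonzero polynomial and can be
   cancelled in an integral domain. *)
pose q : {poly C} := (E x)%:P - (E x)^-1 *: 'X^2.
have qE t : half * q.[E t] = E t * wb (x - t).
  rewrite hornerD hornerN hornerZ hornerXn hornerC !sinhE; field.
  by rewrite !Cexp_neq0 ?oner_eq0.
have q0 : q != 0.
  apply/eqP => /(congr1 (fun r : {poly C} => r`_0)) /eqP.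
  by rewrite coefB coefC coefZ coefXn coef0 mulr0 subr0 (negbTE (Cexp_neq0 _)).
have /eqP : p * q = 0.
  apply: poly_exp_eq0 => t; apply: (mulfI half_neq0).
  rewrite hornerM mulrCA qE -pE mulr0.
  by transitivity (E t ^+ n * E t * (f t * wb (x - t))); [ring|rewrite fx0 mulr0].
rewrite mulf_eq0 (negbTE q0) orbF => /eqP p0.
by apply: (mulfI (expf_neq0 n (Cexp_neq0 z))); rewrite pE p0 horner0 mulr0.
Qed.

Lemma exppoly_cancel_prod f (x : C) (mus : seq C) : exppoly f ->
  (forall z, f z * \prod_(m <- mus) wb (x - (m + z)) = 0) -> forall z, f z = 0.
Proof.
elim: mus f => [|m mus IH] f ef f0; first by move=> z; rewrite -[RHS](f0 z) big_nil mulr1.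
apply: (exppoly_cancel (x := x - m)) => // z; move: z.
apply: IH => [|z].
  by apply: exppolyM => //; apply: trig_exppoly (trig_wbr _).
by rewrite -[RHS](f0 z) big_cons opprD addrA mulrA.
Qed.

End ExponentialPolynomials.

(** * Dependence on a common shift of the inhomogeneities *)

Section ShiftedInhomogeneities.
Variable g : C.

Definition shift (mus : seq C) (z : C) := [seq m + z | m <- mus].

Lemma exppoly_wb (x m : C) : exppoly (fun z => wb (x - (m + z))).
Proof.
apply: trig_exppoly (trig_ext _ (trig_wbr (x - m))) => z.
by rewrite opprD addrA.
Qed.

Lemma exppoly_wa (x m : C) : exppoly (fun z => wa g (x - (m + z))).
Proof. by apply: exppoly_ext (exppoly_wb (x + g) m) => z; rewrite waE addrAC. Qed.

Lemma exppoly_prod_wa (x : C) mus :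
  exppoly (fun z => \prod_(m <- shift mus z) wa g (x - m)).
Proof.
apply: exppoly_ext (exppoly_prod mus xpredT (exppoly_wa x)) => z.
by rewrite big_map.
Qed.

Lemma exppoly_prod_wb (x : C) mus :
  exppoly (fun z => \prod_(m <- shift mus z) wb (x - m)).
Proof.
apply: exppoly_ext (exppoly_prod mus xpredT (exppoly_wb x)) => z.
by rewrite big_map.
Qed.

Lemma exppoly_Tent (x : C) mus a sp s b :
  exppoly (fun z => Tent g x (shift mus z) a sp s b).
Proof.
have eR a' s' b' t m : exppoly (fun z => Rent g (x - (m + z)) a' s' b' t).
  by case: a' s' b' t => [] [] [] []; rewrite /Rent; first
    [exact: exppoly_wa|exact: exppoly_wb|exact: exppolyC].
elim: mus a sp s => [|m mus IH] a [|s1 sp] [|t1 s]; try exact: exppolyC.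
by apply: exppolyD; apply: exppolyM; (exact: eR || exact: IH).
Qed.

Lemma exppoly_Bprod mus xs v sp : exppoly (fun z => Bprod g (shift mus z) xs v sp).
Proof.
elim: xs sp => [|x xs IH] sp; first exact: exppolyC.
apply: (@exppoly_ext (fun z => \sum_(s <- configs (size mus))
   Tent g x (shift mus z) false sp s true * Bprod g (shift mus z) xs v s)).
  by move=> z; rewrite /= /monodromy size_map.
by apply: exppoly_sum => s; apply: exppolyM => //; apply: exppoly_Tent.
Qed.

Lemma exppoly_Zpf mus xs : exppoly (fun z => Zpf g (shift mus z) xs).
Proof.
apply: exppoly_ext (exppoly_Bprod mus xs (vac (size mus)) (nseq (size mus) true)) => z.
by rewrite Zpf_Bprod size_map.
Qed.

End ShiftedInhomogeneities.

(** * Exchange of [x_0] and [x_i] *)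

Section SecondDeterminant.
Variable g : C.

Definition Wi_matrix n (mus : seq C) (y : nat -> C) (i : 'I_n) : 'M[C]_n :=
  \matrix_(a < n, b < n)
    if b == i then
      wb g / wb (y 0%N - y a.+1) * (\prod_(m <- mus) wb (y 0%N - m) *
        \prod_(k < n | k != a) ratio g (y 0%N) (y k.+1))
    else W_matrix g n mus y a b.

(** The points with [y 0] and [y i.+1] swapped. Only indices [k <= n] matter, and there [inord] is
    faithful. *)
Definition exchange n (y : nat -> C) (i : 'I_n) (k : nat) : C :=
  y (tperm ord0 (lift ord0 i) (inord k : 'I_n.+1)).

Lemma full_matrix_perm n mus (x y : nat -> C) (s : 'S_n) :
  (forall k : 'I_n, x k = y (s k)) -> forall i j,
  full_matrix g n mus x i j = full_matrix g n mus y (s i) (s j).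
Proof.
move=> xy i j; rewrite !mxE !xy (inj_eq perm_inj).
case: eqP => _; congr (_ - _ * _) || congr (_ * (_ * _));
  rewrite [RHS](reindex_inj (@perm_inj _ s)) /=.
  by apply: eq_big => k; rewrite ?(inj_eq perm_inj) // xy.
by apply: eq_big => k; rewrite ?(inj_eq perm_inj) // xy.
Qed.

Lemma W_matrix_full n mus y (a b : 'I_n) :
  W_matrix g n mus y a b = full_matrix g n.+1 mus y (lift ord0 a) (lift ord0 b).
Proof.
rewrite !mxE (inj_eq lift_inj) !lift0.
case: eqP => _; rewrite (prod_lift ord0) /= -!mulrA; first by congr (_ - _ * (_ * _)).
by congr (_ * (_ * (_ * (_ * _)))).
Qed.

(** The sign comes from [b] being odd: the numerator-free factor is [b (x_0 - x_a)] on one side and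
    [b (x_a - x_0)] on the other. *)
Lemma full_matrix_col0 n mus y (a : 'I_n) (i : 'I_n) :
  Wi_matrix mus y i a i = - full_matrix g n.+1 mus y (lift ord0 a) ord0.
Proof.
rewrite !mxE eqxx (negbTE (neq_lift _ _)) !lift0 (prod_lift ord0) /=.
rewrite [wb (y a.+1 - _)]wbC invrN mulrN mulNr opprK mul1r.
congr (_ * (_ * _)).
by apply: eq_big => k; rewrite ?(inj_eq lift_inj) ?lift0 //= andbT.
Qed.

Lemma exchangeE n y (i : 'I_n) (k : 'I_n.+1) :
  exchange y i k = y (tperm ord0 (lift ord0 i) k).
Proof. by rewrite /exchange inord_val. Qed.

(** The rows of the full matrix on [n + 1] points satisfy one linear relation, with the residues as
    coefficients. Hence its minors without row [0] and without row [i.+1], on the same columns, are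
    proportional. Up to sign and order they are [det W_i] and the exchanged [det W]. *)
Lemma residue_mul_det n mus y (i : 'I_n) : size mus = n -> distinct n.+1 y ->
  residue n.+1 mus y i.+1 * \det (Wi_matrix mus y i) =
  residue n.+1 mus y 0 * \det (W_matrix g n mus (exchange y i)).
Proof.
move=> sm yD; pose s := tperm ord0 (lift ord0 i).
pose r k := residue n.+1 mus y k.
have [M ME] : {M | M = full_matrix g n.+1 mus y} by exists (full_matrix g n.+1 mus y).
have null (b : 'I_n.+1) : \sum_(a < n.+1) r a * M a b = 0 by rewrite ME; apply: kostov_left_null.
pose N : 'M[C]_n := \matrix_(a, b) M (lift ord0 a) (s (lift ord0 b)).
have sE b : s (lift ord0 b) = if b == i then ord0 else lift ord0 b.
  case: eqP => [->|/eqP bi]; first by rewrite /s tpermR.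
  by rewrite /s tpermD ?neq_lift // (inj_eq lift_inj) eq_sym.
have SE : W_matrix g n mus (exchange y i) = \matrix_(a, b) M (s (lift ord0 a)) (s (lift ord0 b)).
  apply/matrixP => a b; rewrite W_matrix_full [RHS]mxE ME.
  by apply: full_matrix_perm => k; rewrite exchangeE.
have NE a b : N a b = M (lift ord0 a) (if b == i then ord0 else lift ord0 b).
  by rewrite mxE sE.
have -> : \det (Wi_matrix mus y i) = - \det N.
  have -> : Wi_matrix mus y i = N *m diag_mx (\row_b (if b == i then -1 else 1)).
    rewrite mul_mx_diag; apply/matrixP => a b; rewrite [RHS]mxE [X in _ * X]mxE NE.
    case: eqP => [->|/eqP bi]; first by rewrite full_matrix_col0 mulrN1 ME.
    by rewrite mulr1 mxE (negbTE bi) W_matrix_full ME.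
  rewrite det_mulmx det_diag (bigD1 i) //= mxE eqxx big1 => [|k ki].
    by rewrite mulr1 mulrN1.
  by rewrite mxE (negbTE ki).
pose m0 : 'rV[C]_n := \row_b M ord0 (s (lift ord0 b)).
pose rr : 'rV[C]_n := \row_a r (lift ord0 a).
have rN : rr *m N = - r 0%N *: m0.
  apply/rowP => b; rewrite [RHS]mxE [m0 _ _]mxE mulNr.
  have /eqP := null (s (lift ord0 b)); rewrite big_ord_recl addr_eq0 => /eqP ->.
  by rewrite opprK mxE; apply: eq_bigr => a _; rewrite !mxE.
(* Cramer's rule: entry [i] of [m0 *m \adj N] is the determinant of [N] with row [i] replaced by
   [m0]. *)
have := congr1 (fun u : 'rV[C]_n => (u *m \adj N) ord0 i) rN.
rewrite -mulmxA mul_mx_adj mul_mx_scalar -scalemxAl !mxE lift0 mulrC => e.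
rewrite mulrN e mulNr opprK; congr (_ * _).
(* The exchanged matrix differs from [N] only in row [i], where it is [m0], so the cofactors along
   that row agree. *)
rewrite (expand_det_row _ i); apply: eq_bigr => b _.
rewrite SE !mxE [s (lift ord0 i)]sE eqxx; congr (_ * _).
rewrite /cofactor; congr (_ * \det _); apply/matrixP => a c.
by rewrite !mxE [s (lift ord0 (lift i a))]sE eq_sym (negbTE (neq_lift _ _)).
Qed.

Lemma distinct_exchange n y (i : 'I_n) : distinct n.+1 y -> distinct n.+1 (exchange y i).
Proof.
move=> yD a b an bn ab.
rewrite -[a]/(val (Ordinal an)) -[b]/(val (Ordinal bn)) !exchangeE; apply: yD => //.
by rewrite (inj_eq val_inj) (inj_eq perm_inj).
Qed.

Lemma prod_exchange n y (i : 'I_n) :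
  \prod_(k < n) wb (exchange y i 0 - exchange y i k.+1) =
  \prod_(j < n.+1 | j != i.+1 :> nat) wb (y i.+1 - y j).
Proof.
pose s := tperm ord0 (lift ord0 i).
rewrite (exchangeE y i ord0) tpermL lift0 [RHS](reindex_inj (@perm_inj _ s)).
rewrite [RHS](prod_lift ord0) /= /s tpermL lift0 eqxx mul1r.
apply: eq_big => [k|k _].
  rewrite -[i.+1]/(val (lift ord0 i)) (inj_eq val_inj).
  by rewrite -[X in _ = (_ != X)](tpermL ord0) (inj_eq perm_inj) eq_sym neq_lift.
by rewrite -(exchangeE y i (lift ord0 k)).
Qed.

(** The first formula at the exchanged points replaces the exchanged [det W] by a partition
    function. The residue at [y i.+1] brings in the last product, which may vanish and so cannot
    simply be divided out. *)
Lemma det_Wi_matrix_mul n mus y (i : 'I_n) : size mus = n -> distinct n.+1 y ->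
  (Zpf g mus [seq exchange y i k | k <- iota 1 n] * \prod_(m <- mus) wb (y 0%N - m)
   - \det (Wi_matrix mus y i) * \prod_(k < n) wb (y 0%N - y k.+1))
  * \prod_(m <- mus) wb (y i.+1 - m) = 0.
Proof.
move=> sm yD; have := det_W_matrix g sm (distinct_exchange i yD).
rewrite prod_exchange (exchangeE y i ord0) tpermL lift0 => dW.
have := residue_mul_det i sm yD; rewrite /residue.
have -> : \prod_(j < n.+1 | j != 0%N :> nat) wb (y 0%N - y j) =
          \prod_(k < n) wb (y 0%N - y k.+1).
  by rewrite (prod_lift ord0) /= mul1r; apply: eq_big => k; rewrite ?lift0.
set Di := \prod_(j < n.+1 | _) _ in dW *; set D0 := \prod_(k < n) _.
set Pi := \prod_(m <- mus) wb (y i.+1 - m) in dW *; set P0 := \prod_(m <- mus) _.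
have Di0 : Di != 0 by apply: prod_neq0 => k ki; apply: yD => //; rewrite ?ltnS ?ltn_ord // eq_sym.
have D00 : D0 != 0 by apply: prod_neq0 => k ki; apply: yD => //; rewrite ltnS ltn_ord.
move=> /(congr1 (fun t => t * (D0 * Di))) e; rewrite mulrBl.
apply/eqP; rewrite subr_eq0; apply/eqP.
transitivity (P0 / D0 * \det (W_matrix g n mus (exchange y i)) * (D0 * Di)).
  by rewrite mulrAC -dW; field.
by rewrite -e; field.
Qed.

(* Both sides are exponential polynomials in a common shift of the inhomogeneities, so
   the factor [prod_k b (x_i - mu_k)] of the previous lemma can be cancelled even where
   it vanishes. *)
Lemma det_Wi_matrix n mus y (i : 'I_n) : size mus = n -> distinct n.+1 y ->
  \det (Wi_matrix mus y i) * \prod_(k < n) wb (y 0%N - y k.+1) =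
  Zpf g mus [seq exchange y i k | k <- iota 1 n] * \prod_(m <- mus) wb (y 0%N - m).
Proof.
move=> sm yD; apply/esym/eqP; rewrite -subr_eq0; apply/eqP.
pose f z := Zpf g (shift mus z) [seq exchange y i k | k <- iota 1 n] *
    \prod_(m <- shift mus z) wb (y 0%N - m)
  - \det (Wi_matrix (shift mus z) y i) * \prod_(k < n) wb (y 0%N - y k.+1).
suff f0 : forall z, f z = 0.
  by rewrite -[RHS](f0 0) /f /shift (eq_map (@addr0 _)) map_id.
apply: (@exppoly_cancel_prod f (y i.+1) mus) => [|z].
  apply: exppolyB; first by apply: exppolyM; [apply: exppoly_Zpf|apply: exppoly_prod_wb].
  apply: exppolyM; last exact: exppolyC.
  apply: exppoly_det => a b.
  apply: (@exppoly_ext (fun z => if b == i then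
      wb g / wb (y 0%N - y a.+1) * (\prod_(m <- shift mus z) wb (y 0%N - m) *
        \prod_(k < n | k != a) ratio g (y 0%N) (y k.+1))
    else W_matrix g n (shift mus z) y a b)); first by move=> t; rewrite [RHS]mxE.
  case: (b == i).
    by apply: exppolyZ; apply: exppolyM; [apply: exppoly_prod_wb|apply: exppolyC].
  have eQ c : exppoly (fun z => \prod_(m <- shift mus z) wb (y c.+1 - m)
                                * ratio g (y c.+1) (y 0%N)).
    by apply: exppolyM; [apply: exppoly_prod_wb|apply: exppolyC].
  have [ba|ba] := eqVneq b a.
    apply: (@exppoly_ext (fun z => \prod_(m <- shift mus z) wa g (y a.+1 - m) -
      \prod_(m <- shift mus z) wb (y a.+1 - m) * ratio g (y a.+1) (y 0%N) *
      \prod_(k < n | k != a) ratio g (y a.+1) (y k.+1))).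
      by move=> t; rewrite mxE ba eqxx.
    apply: exppolyB; first exact: exppoly_prod_wa.
    by apply: exppolyM => //; apply: exppolyC.
  apply: (@exppoly_ext (fun z => wb g / wb (y a.+1 - y b.+1) *
     (\prod_(m <- shift mus z) wb (y b.+1 - m) * ratio g (y b.+1) (y 0%N) *
      \prod_(k < n | (k != a) && (k != b)) ratio g (y b.+1) (y k.+1)))).
    by move=> t; rewrite mxE (negbTE ba).
  by apply: exppolyZ; apply: exppolyM => //; apply: exppolyC.
have := @det_Wi_matrix_mul n (shift mus z) y i; rewrite size_map => /(_ sm yD) <-.
by congr (_ * _); rewrite big_map.
Qed.

End SecondDeterminant.

(** * Comparison with the definitions *)

Lemma list_mapE (T U : Type) (f : T -> U) l : List.map f l = map f l.
Proof. by elim: l => //= a l ->. Qed.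

Lemma list_seqE m n : List.seq m n = iota m n.
Proof. by elim: n m => //= n IH m; rewrite IH. Qed.

Lemma det_determinant n (M : nat -> nat -> C) : det n M = \det (\matrix_(i < n, j < n) M i j).
Proof.
elim: n M => [|n IH] M; first by rewrite det_mx00.
have -> : det n.+1 M =
    \sum_(j < n.+1) (if Nat.even j then 1 else -1) * (M 0%N j * det n (minor M j)).
  rewrite [LHS]Csum_map list_seqE -[iota 0 n.+1]/(index_iota 0 n.+1) big_mkord.
  exact: eq_bigr.
rewrite (expand_det_row _ ord0); apply: eq_bigr => j _.
rewrite mxE mulrCA IH /cofactor; congr (_ * _); congr (_ * _).
  rewrite add0n -signr_odd; have -> : Nat.even j = ~~ odd j.
    by elim: (nat_of_ord j) => // k IHk; rewrite PeanoNat.Nat.even_succ -PeanoNat.Nat.negb_even IHk.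
  by case: (odd j); rewrite ?expr1.
congr (\det _); apply/matrixP => a b; rewrite !mxE /minor /= /bump leq0n add1n; congr (M _ _).
have -> : Nat.ltb b j = (b < j)%N by apply/PeanoNat.Nat.ltb_spec0/idP => /ltP.
by rewrite ltnNge; case: leqP.
Qed.

Lemma prodkE lo hi P (f : nat -> C) : prodk lo hi P f = \prod_(lo <= k < hi.+1 | P k) f k.
Proof.
rewrite /prodk list_seqE unlock /index_iota -[(hi.+1 - lo)%coq_nat]/(hi.+1 - lo)%N.
by elim: (iota _ _) => //= k l IH; case: (P k); rewrite //= IH.
Qed.

Lemma prodk1E L P (f : nat -> C) : prodk 1 L P f = \prod_(k < L | P k.+1) f k.+1.
Proof. by rewrite prodkE big_add1 big_mkord. Qed.

Lemma prodk0E L P (f : nat -> C) : prodk 0 L P f = \prod_(k < L.+1 | P k) f k.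
Proof. by rewrite prodkE big_mkord. Qed.

Lemma prod_mulist L (mu : nat -> C) (F : C -> C) :
  \prod_(m <- mulist L mu) F m = \prod_(k < L) F (mu k.+1).
Proof. by rewrite /mulist list_mapE list_seqE big_map prod_iota. Qed.

Lemma size_mulist L mu : size (mulist L mu) = L.
Proof. by rewrite /mulist list_mapE size_map list_seqE size_iota. Qed.

Lemma eqbE m n : Nat.eqb m n = (m == n).
Proof. by apply/PeanoNat.Nat.eqb_spec/eqP. Qed.

Lemma Wmat_W_matrix g L mu x (a b : 'I_L) :
  Wmat g L mu x a b = W_matrix g L (mulist L mu) x a b.
Proof.
rewrite [RHS]mxE /Wmat /Wentry eqbE eqSS -[(b == a :> nat)]/(b == a) !prodk1E !prodk0E.
rewrite !prod_mulist !CringE.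
case: eqP => _; rewrite (prod_lift ord0) /= ?eqbE.
  by congr (_ - _); rewrite -mulrA; congr (_ * (_ * _)).
by congr (_ * _); rewrite -mulrA; congr (_ * (_ * _)).
Qed.

Lemma Wimat_Wi_matrix g L mu x (i a b : 'I_L) :
  Wimat g L mu x i.+1 a b = Wi_matrix g (mulist L mu) x i a b.
Proof.
rewrite [RHS]mxE /Wimat /Wi_entry eqbE eqSS -[(b == i :> nat)]/(b == i).
case: eqP => _; last exact: Wmat_W_matrix.
by rewrite /Wicol !prodk1E prod_mulist !CringE; congr (_ * (_ * _)).
Qed.

Lemma prefactorE L mu x : prefactor L mu x =
  \prod_(k < L) wb (x 0%N - x k.+1) / \prod_(m <- mulist L mu) wb (x 0%N - m).
Proof. by rewrite /prefactor prodk1E prod_mulist -prodf_div. Qed.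

Lemma Xi0list_exchange L x (i : 'I_L) :
  Xi0list L x i.+1 = [seq exchange x i k | k <- iota 1 L].
Proof.
rewrite /Xi0list list_mapE list_seqE; apply/eq_in_map => k.
rewrite mem_iota add1n => /andP[k0 kL].
rewrite eqbE -[in RHS](inordK kL) exchangeE.
have [->|ki] := eqVneq k i.+1.
  have -> : inord i.+1 = lift ord0 i by apply: val_inj; rewrite /= inordK ?ltnS ?ltn_ord.
  by rewrite tpermR.
rewrite tpermD ?inordK // -val_eqE /= inordK //; first by rewrite eq_sym -lt0n.
by rewrite eq_sym.
Qed.

Lemma determinant_formulas g L mu x :
  (forall k, le 1 k /\ le k L -> wb (Csub (x 0%N) (mu k)) <> C0) ->
  (forall j k, le j L -> le k L -> j <> k -> wb (Csub (x j) (x k)) <> C0) ->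
  Zpf g (mulist L mu) (Xlist L x) = Cmul (det L (Wmat g L mu x)) (prefactor L mu x)
  /\ (forall i, le 1 i /\ le i L ->
        Zpf g (mulist L mu) (Xi0list L x i)
        = Cmul (det L (Wimat g L mu x i)) (prefactor L mu x)).
Proof.
move=> mu0 x0.
have xD : distinct L.+1 x.
  move=> j k jL kL jk; apply/eqP; apply: x0; [exact/leP|exact/leP|exact/eqP].
have P0 : \prod_(m <- mulist L mu) wb (x 0%N - m) != 0.
  rewrite prod_mulist; apply: prod_neq0 => k _; apply/eqP; apply: mu0.
  by split; apply/leP.
rewrite prefactorE; split=> [|[|i] [/leP i0 /leP iL] //].
- have := det_W_matrix g (size_mulist L mu) xD.
  rewrite CmulE det_determinant /Xlist list_mapE list_seqE mulrA.
  have -> : (\matrix_(a < L, b < L) Wmat g L mu x a b) = W_matrix g L (mulist L mu) x.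
    by apply/matrixP => a b; rewrite mxE Wmat_W_matrix.
  by move=> ->; rewrite mulfK.
- have := det_Wi_matrix g (Ordinal iL) (size_mulist L mu) xD.
  rewrite CmulE det_determinant (Xi0list_exchange x (Ordinal iL)) mulrA.
  have -> : (\matrix_(a < L, b < L) Wimat g L mu x i.+1 a b) =
            Wi_matrix g (mulist L mu) x (Ordinal iL).
    by apply/matrixP => a b; rewrite mxE (Wimat_Wi_matrix _ _ _ (Ordinal iL)).
  by move=> ->; rewrite mulfK.
Qed.

End SixVertex.

Theorem theorem6p4 (g : C) (L : nat) (mu x : nat -> C) :
  (1 <= L)%nat ->
  (* genericity of x_0, ..., x_L: all denominators are nonzero *)
  (forall k, (1 <= k <= L)%nat -> wb (Csub (x 0%nat) (mu k)) <> C0) ->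
  (forall j k, (j <= L)%nat -> (k <= L)%nat -> j <> k -> wb (Csub (x j) (x k)) <> C0) ->
  Zpf g (mulist L mu) (Xlist L x) = Cmul (det L (Wmat g L mu x)) (prefactor L mu x)
  /\ (forall i, (1 <= i <= L)%nat ->
        Zpf g (mulist L mu) (Xi0list L x i)
        = Cmul (det L (Wimat g L mu x i)) (prefactor L mu x)).
Proof. exact (fun _ => @SixVertex.determinant_formulas g L mu x). Qed.
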